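(* Let $\mathcal{H}$ be a real Hilbert space, let $\alpha\in\,]0,+\infty[$, let $W\colon\mathcal{H}\to 2^{\mathcal{H}}$ be maximally monotone, let $C\colon\mathcal{H}\to\mathcal{H}$ be $\alpha$-cocoercive and such that $Z=\mathrm{zer}(W+C)\neq\varnothing$, let $x_0\in\mathcal{H}$, and let $(\lambda_n)_{n\in\mathbb{N}}$ be a sequence in $]0,2[$. Further, for every $n\in\mathbb{N}$, let $U_n\colon\mathcal{H}\to\mathcal{H}$ be an operator such that $\mathrm{ran}\,U_n\subset\mathrm{ran}(U_n+W+C)$ and $U_n+W+C$ is injective. Iterate, for every $n\in\mathbb{N}$, $$w_n=J_{W+C}^{U_n}x_n,\qquad w_n^*=U_nx_n-U_nw_n-Cw_n,\qquad q_n\in\mathcal{H}\ \text{(arbitrary)},\qquad t_n^*=w_n^*+Cq_n,$$ $$\delta_n=\langle x_n-w_n\mid t_n^*\rangle-\frac{\|w_n-q_n\|^2}{4\alpha},\qquad d_n=\begin{cases}\dfrac{\delta_n}{\|t_n^*\|^2}t_n^*,&\text{if }\delta_n>0;\\ 0,&\text{otherwise,}\end{cases}\qquad x_{n+1}=x_n-\lambda_nd_n.$$ Then the following hold: (i) $\sum_{n\in\mathbb{N}}\lambda_n(2-\lambda_n)\|d_n\|^2<+\infty$. (ii) Suppose that one of the following is satisfied: (a) $\sum_{n\in\mathbb{N}}\lambda_n(2-\lambda_n)=+\infty$ and $(\|d_n\|)_{n\in\mathbb{N}}$ converges; (b) $\inf_{n\in\mathbb{N}}\lambda_n>0$ and $\sup_{n\in\mathbb{N}}\lambda_n<2$;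 together with one of the following: (c) $w_n-x_n\rightharpoonup 0$, $U_nw_n-U_nx_n\to 0$, and $w_n-q_n\to 0$; (d) $q_n-x_n\to 0$ and there exist $\beta_1\in\,]1/(4\alpha),+\infty[$ and $\beta_2\in\,]0,+\infty[$ such that the operators $(U_n)_{n\in\mathbb{N}}$ are $\beta_1$-strongly monotone and $\beta_2$-Lipschitzian. Then $(x_n)_{n\in\mathbb{N}}$ converges weakly to a point in $Z$.
   Context: For $M\colon\mathcal{H}\to2^{\mathcal{H}}$, $\mathrm{gra}\,M=\{(x,x^* )\mid x^*\in Mx\}$, $\mathrm{ran}\,M=\bigcup_x Mx$, $\mathrm{zer}\,M=\{x\mid 0\in Mx\}$, and $M^{-1}$ is the set-valued inverse. $M$ is injective if $Mx\cap My\neq\varnothing$ implies $x=y$. $M$ is monotone if $\langle x-y\mid x^*-y^*\rangle\ge0$ for all $(x,x^* ),(y,y^* )\in\mathrm{gra}\,M$, maximally monotone if no monotone operator has a graph strictly containing $\mathrm{gra}\,M$, and $\beta$-strongly monotone if $\langle x-y\mid x^*-y^*\rangle\ge\beta\|x-y\|^2$ on its graph. $C$ is $\alpha$-cocoercive if $\langle x-y\mid Cx-Cy\rangle\ge\alpha\|Cx-Cy\|^2$ for all $x,y$. If $\mathrm{ran}\,U\subset\mathrm{ran}(U+M)$ and $U+M$ is injective, the warped resolvent of $M$ with kernel $U\colon\mathcal{H}\to\mathcal{H}$ is the (single-valued, everywhere defined) operator $J_M^U=(U+M)^{-1}\circ U$. $\rightharpoonup$ and $\to$ denote weak and strong convergence.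 *)

(* Defs.v *)
From HB Require Import structures.
From mathcomp Require Import all_boot all_order all_algebra.
From mathcomp Require Import sesquilinear.
From mathcomp Require Import all_classical all_reals all_analysis.

Set Implicit Arguments.
Unset Strict Implicit.
Unset Printing Implicit Defensive.

Import Order.TTheory GRing.Theory Num.Theory.
Import numFieldNormedType.Exports.

Local Open Scope classical_set_scope.
Local Open Scope ring_scope.

(* [{dot H for idfun}] is the library's type of symmetric, positive definite
   bilinear forms on [H]; [inner_norm] makes the norm the one it induces. *)
HB.mixin Record CompleteNormedModule_isHilbert (R : realType) (H : Type)
    of CompleteNormedModule R H := {
  inner : {dot H for (@idfun R)} ;
  inner_norm : forall x : H, inner x x = `|x| ^+ 2
}.

#[short(type="hilbertType")]
HB.structure Definition Hilbert (R : realType) :=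
  {H of CompleteNormedModule R H & CompleteNormedModule_isHilbert R H}.

Reserved Notation "'⟨' x | y '⟩'" (at level 0, x at level 99, y at level 99,
  format "'⟨' x  |  y '⟩'").
Notation "'⟨' x | y '⟩'" := (inner x y) : ring_scope.

Section SetValuedOperators.
Context {R : realType} {H : hilbertType R}.
Implicit Types (M N : H -> set H) (U : H -> H).

Definition gra M : set (H * H) := [set p | M p.1 p.2].
Definition ran M : set H := \bigcup_x M x.
Definition zer M : set H := [set x | M x 0].
Definition inv_op M : H -> set H := fun y => [set x | M x y].

Definition sv U : H -> set H := fun x => [set U x].
Definition add_op M N : H -> set H :=
  fun x => [set a + b | a in M x & b in N x].

Definition injective_op M : Prop :=
  forall x y, M x `&` M y !=set0 -> x = y.

Definition monotone M : Prop :=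
  forall p q, gra M p -> gra M q -> 0 <= ⟨p.1 - q.1 | p.2 - q.2⟩.

Definition maximally_monotone M : Prop :=
  monotone M /\ forall N, monotone N -> ~ (gra M `<` gra N).

Definition strongly_monotone (beta : R) M : Prop :=
  forall p q, gra M p -> gra M q ->
    beta * `|p.1 - q.1| ^+ 2 <= ⟨p.1 - q.1 | p.2 - q.2⟩.

Definition cocoercive (alpha : R) (C : H -> H) : Prop :=
  forall x y, alpha * `|C x - C y| ^+ 2 <= ⟨x - y | C x - C y⟩.

(* Set-valued, so that it makes sense for every [U] and [M];
   [warped_resolvent_single] is its single-valuedness. *)
Definition warped_resolvent U M : H -> set H :=
  inv_op (add_op (sv U) M) \o U.

Lemma warped_resolvent_single U M :
  ran (sv U) `<=` ran (add_op (sv U) M) -> injective_op (add_op (sv U) M) ->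
  forall x, exists w, warped_resolvent U M x = [set w].
Proof.
move=> sub inj x.
have [|w _ Mw] := sub (U x); first by exists x.
exists w; apply/seteqP; split => [v Mv|v ->]; last exact: Mw.
by apply: inj; exists (U x).
Qed.

Definition weakly_cvg (x : nat -> H) (l : H) : Prop :=
  forall u : H, ⟨x n | u⟩ @[n --> \oo] --> ⟨l | u⟩.

End SetValuedOperators.

(* Main.v *)
(* For every zero [z] of [W + C], cocoercivity and monotonicity put [z] in the
   half-space [<u - w n|tstar n> <= |w n - q n|^2 / (4 alpha)], and [x n.+1] is
   a relaxed projection of [x n] onto it; hence [x] is Fejer monotone and (i)
   follows by telescoping.  Under (d), [d n --> 0] and a quadratic inequality
   in [|x n - w n|] give [w n - x n --> 0], which reduces (d) to (c).  Under
   (c), weak cluster points of [x] are weak cluster points of [w], and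
   [wstar n + C (w n) --> 0] with demiclosedness of [W + C] makes them zeros;
   Opial's argument concludes.  Weak cluster points are taken along
   ultrafilters finer than [\oo] instead of along subsequences. *)
Require Import Defs.
From mathcomp Require Import all_boot all_order all_algebra.
From mathcomp Require Import sesquilinear.
From mathcomp Require Import all_classical all_reals all_analysis.
From mathcomp Require Import ring lra zify.

Set Implicit Arguments.
Unset Strict Implicit.
Unset Printing Implicit Defensive.

Import Order.TTheory GRing.Theory Num.Theory.
Import numFieldNormedType.Exports.
Local Open Scope classical_set_scope.
Local Open Scope ring_scope.

(** * Inner product identities and the Cauchy-Schwarz inequality *)

Section InnerProduct.
Context {R : realType} {H : hilbertType R}.
Implicit Types (x y z u : H) (a : R).

Lemma innerC x y : ⟨x|y⟩ = ⟨y|x⟩.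
Proof. by rewrite hermC expr0 mul1r. Qed.

Lemma innerxx x : ⟨x|x⟩ = `|x| ^+ 2.
Proof. exact: inner_norm. Qed.

Lemma innerDl x y z : ⟨x + y|z⟩ = ⟨x|z⟩ + ⟨y|z⟩.
Proof. exact: linearDl. Qed.

Lemma innerBl x y z : ⟨x - y|z⟩ = ⟨x|z⟩ - ⟨y|z⟩.
Proof. exact: linearBl. Qed.

Lemma innerZl a x z : ⟨a *: x|z⟩ = a * ⟨x|z⟩.
Proof. exact: linearZl_LR. Qed.

Lemma innerDr x y z : ⟨z|x + y⟩ = ⟨z|x⟩ + ⟨z|y⟩.
Proof. exact: linearDr. Qed.

Lemma innerBr x y z : ⟨z|x - y⟩ = ⟨z|x⟩ - ⟨z|y⟩.
Proof. exact: linearBr. Qed.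

Lemma innerZr a x z : ⟨z|a *: x⟩ = a * ⟨z|x⟩.
Proof. by rewrite innerC innerZl innerC. Qed.

Lemma inner0r x : ⟨x|0⟩ = 0.
Proof. exact: linear0r. Qed.

Definition innerE :=
  (innerBl, innerBr, innerDl, innerDr, innerZl, innerZr).

Lemma normDsq x y : `|x + y| ^+ 2 = `|x| ^+ 2 + 2 * ⟨x|y⟩ + `|y| ^+ 2.
Proof. by rewrite -!innerxx !innerE (innerC y x); ring. Qed.

Lemma normBsq x y : `|x - y| ^+ 2 = `|x| ^+ 2 - 2 * ⟨x|y⟩ + `|y| ^+ 2.
Proof. by rewrite -!innerxx !innerE (innerC y x); ring. Qed.

(** The squared norm of [|y| x - |x| y] is nonnegative and equals [2 |x| |y| (|x| |y| - <x|y>)];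
    setting the zero vectors aside makes the first factor positive. *)
Lemma le_inner_norm x y : ⟨x|y⟩ <= `|x| * `|y|.
Proof.
have [->|y0] := eqVneq y 0; first by rewrite inner0r normr0 mulr0.
have [->|x0] := eqVneq x 0; first by rewrite innerC inner0r normr0 mul0r.
have := exprn_ge0 2 (normr_ge0 (`|y| *: x - `|x| *: y)).
rewrite -innerxx !innerE !innerxx (innerC y x).
rewrite [leRHS](_ : _ = 2 * (`|x| * `|y|) * (`|x| * `|y| - ⟨x|y⟩));
  last by ring.
by rewrite pmulr_rge0 ?subr_ge0// !mulr_gt0 ?normr_gt0.
Qed.

Lemma norm_inner_le x y : `|⟨x|y⟩| <= `|x| * `|y|.
Proof.
rewrite ler_norml le_inner_norm andbT lerNl -mulN1r -innerZl.
by rewrite (le_trans (le_inner_norm _ _))// scaleN1r normrN.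
Qed.

End InnerProduct.

(* The representing vector minimizes [u |-> |u|^2 - 2 phi u]; the
   parallelogram law makes minimizing sequences Cauchy. *)
Lemma riesz_representation (R : realType) (H : hilbertType R) (phi : H -> R)
    (M : R) :
  scalar phi -> (forall u, `|phi u| <= M * `|u|) ->
  exists z : H, forall u, phi u = ⟨z|u⟩.
Proof.
move=> phi_lin phiM.
have phiD u v : phi (u + v) = phi u + phi v.
  by rewrite -[u]scale1r phi_lin scale1r mul1r.
have phi0 : phi 0 = 0 by have := phiD 0 0; rewrite addr0 => h; lra.
have phiZ a u : phi (a *: u) = a * phi u.
  by rewrite -[a *: u]addr0 phi_lin phi0 addr0.
pose f u : R := `|u| ^+ 2 - 2 * phi u.
have f_lb : lbound (range f) (- M ^+ 2).
  move=> _ [u _ <-]; rewrite /f.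
  have := phiM u; have := ler_norm (phi u); have := sqr_ge0 (`|u| - M).
  by move=> *; nra.
have f_inf : has_inf (range f).
  by split; [exists (f 0), 0|exists (- M ^+ 2)].
pose m := inf (range f).
have mf u : m <= f u by apply: ge_inf; [exists (- M ^+ 2)|exists u].
(* The parallelogram law gives [|y - z|^2 = 2 f y + 2 f z - 4 f ((y + z) / 2)], and the midpoint
   value is at least [m]. *)
have par y z : `|y - z| ^+ 2 <= 2 * (f y - m) + 2 * (f z - m).
  have := mf (2^-1 *: (y + z)).
  rewrite /f phiZ phiD normrZ exprMn gtr0_norm ?invr_gt0// normDsq normBsq.
  by move=> ?; nra.
have /choice[y yP] : forall k, exists u, f u < m + k.+1%:R^-1.
  move=> k; have [|_ [u _ <-] hu] := inf_adherent (eps := k.+1%:R^-1) _ f_inf.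
    by rewrite invr_gt0.
  by exists u.
have y_cvg : cvgn y.
  apply: cauchy_cvg; apply: cauchy_exP => e e0.
  (* From [N] on, [y] misses the infimum by less than [1/(N+1)], so [par] bounds squared distances
     by [4/(N+1)]. *)
  have [N NP] : exists N : nat, 4 * N.+1%:R^-1 < e ^+ 2.
    have e2 : 0 < e ^+ 2 / 4 by rewrite divr_gt0// exprn_gt0.
    have [N _ /(_ N (leqnn N)) hN] := near_infty_natSinv_lt (PosNum e2).
    by exists N; move: hN; rewrite /= ltr_pdivlMr// mulrC.
  exists (y N); exists N => // n /= Nn; rewrite -ball_normE /ball_/=.
  rewrite -(ltr_pXn2r (n := 2)) ?nnegrE// ?ltW//.
  apply: le_lt_trans NP.
  have nN : n.+1%:R^-1 <= N.+1%:R^-1 :> R.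
    by rewrite lef_pV2 ?posrE// ler_nat ltnS.
  have := par (y N) (y n); have := yP N; have := yP n.
  by move: (f (y N)) (f (y n)) (n.+1%:R^-1) (N.+1%:R^-1) nN => *; lra.
pose z := limn y.
have phi_cvg : phi (y n) @[n --> \oo] --> phi z.
  apply/cvgrPdist_le => e e0.
  have M1 : 0 < `|M| + 1 by rewrite ltr_wpDl.
  have /cvgrPdist_le/(_ (e / (`|M| + 1))) := y_cvg.
  rewrite divr_gt0// => /(_ isT); apply: filterS => n hn.
  have -> : phi z - phi (y n) = phi (z - y n).
    by rewrite phiD -(scaleN1r (y n)) phiZ mulN1r.
  apply: (le_trans (phiM _)).
  apply: (le_trans (y := (`|M| + 1) * `|z - y n|)).
    by rewrite ler_wpM2r// (le_trans (ler_norm M))// lerDl.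
  by rewrite mulrC -ler_pdivlMr.
have fz : f z <= m.
  have h1 : f (y n) @[n --> \oo] --> f z.
    apply: cvgB; last by apply: cvgMr; exact: phi_cvg.
    by rewrite expr2; under eq_fun do rewrite expr2; apply: cvgM; apply: cvg_norm.
  have h2 : m + n.+1%:R^-1 @[n --> \oo] --> m.
    by rewrite -[X in _ --> X]addr0; apply: cvgD;
      [exact: cvg_cst|exact: cvg_harmonic].
  by apply: (ler_cvg_to h1 h2); near=> n; exact/ltW/yP.
exists z => u; apply/eqP; rewrite -subr_eq0; apply/eqP.
set c := phi u - _.
have hc t : 0 <= t ^+ 2 * `|u| ^+ 2 - 2 * t * c.
  have := le_trans fz (mf (z + t *: u)).
  rewrite /f normDsq phiD phiZ normrZ exprMn real_normK ?num_real// innerZr /c.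
  by move=> ?; lra.
(* The [+ 1] keeps [s] positive when [u] is 0. At [t = c / s] the quadratic of [hc] equals
   [- c^2 (s + 1) / s^2], which is nonnegative only for [c = 0]. *)
pose s := `|u| ^+ 2 + 1; have s0 : 0 < s by rewrite ltr_wpDl// exprn_ge0.
have := hc (c / s); rewrite (_ : _ - _ = - c ^+ 2 * (s + 1) / s ^+ 2); last first.
  by rewrite /s; field; rewrite -/s gt_eqF.
rewrite pmulr_lge0 ?invr_gt0 ?exprn_gt0// mulNr oppr_ge0.
rewrite pmulr_lle0; last by rewrite addr_gt0.
by move=> c2; apply/eqP; rewrite -sqrf_eq0 eq_le c2 sqr_ge0.
Unshelve. all: by end_near. Qed.

(** * Convergence along ultrafilters *)

Lemma cvg_ultraP (I : Type) (T : topologicalType) (F : set_system I)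
    (u : I -> T) (l : T) : Filter F ->
  (forall G, UltraFilter G -> F `<=` G -> u @ G --> l) -> u @ F --> l.
Proof.
move=> FF ultra_l A Al; apply: contrapT => nFA.
(* If the preimage of [A] is not in [F], restricting [F] to its complement gives a proper filter; an
   ultrafilter finer than that would contain both sets. *)
have WP : ProperFilter (within (~` (u @^-1` A)) F).
  split; last exact: within_filter.
  rewrite /within/= => F0; apply: nFA.
  by apply: filterS F0 => i; exact: contrapT.
have [G [GU WG]] := ultraFilterLemma WP.
have FG : F `<=` G.
  by move=> B FB; apply: WG; rewrite /within/=; apply: filterS FB.
have GA : G (~` (u @^-1` A)) by apply: WG; exact: withinT.
have GA' : G (u @^-1` A) by exact: ultra_l.
by have [i []] := filter_ex (filterI GA GA').
Qed.

(** Compactness of [[-M, M]] provides a cluster point, and a cluster point of an ultrafilter is a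
    limit. *)
Lemma ultra_cvg_bounded (R : realType) (I : Type) (F : set_system I)
    (u : I -> R) (M : R) : UltraFilter F -> (forall i, `|u i| <= M) ->
  exists l : R, u @ F --> l.
Proof.
move=> FU uM.
have [|l [_ ul]] := @segment_compact R (- M) M (u @ F) _.
  rewrite /= /fmap/=; apply: filterS filterT => i _ /=.
  by rewrite in_itv/= -ler_norml.
exists l => A Al.
have [//|FnA] := in_ultra_setVsetC (u @^-1` A) FU.
by have [x []] := ul (~` A) A FnA Al.
Qed.

(** * Weak convergence, weak cluster points and boundedness *)

Section WeakConvergence.
Context {R : realType} {H : hilbertType R}.
Implicit Types (x y : nat -> H) (F : set_system nat).

Lemma cvg_inner_bounded_strong F x e (M : R) : Filter F ->
  (forall n, `|x n| <= M) -> e n @[n --> F] --> (0 : H) ->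
  ⟨x n|e n⟩ @[n --> F] --> (0 : R).
Proof.
move=> FF xM /norm_cvg0P e0; apply/norm_cvg0P.
apply: (@squeeze_cvgr _ _ _ _ (cst 0) (fun n => M * `|e n|)).
- apply: nearW => n; rewrite normr_ge0/=.
  by rewrite (le_trans (norm_inner_le _ _))// ler_wpM2r.
- exact: cvg_cst.
- by rewrite -[X in _ --> X](mulr0 M); apply: cvgMr.
Qed.

Lemma cvg_inner_weak_strong F x y (a b : H) (M : R) : Filter F ->
  (forall n, `|x n| <= M) -> (forall u, ⟨x n|u⟩ @[n --> F] --> ⟨a|u⟩) ->
  y n @[n --> F] --> b -> ⟨x n|y n⟩ @[n --> F] --> ⟨a|b⟩.
Proof.
move=> FF xM xa yb.
have -> : (fun n => ⟨x n|y n⟩) = (fun n => ⟨x n|y n - b⟩ + ⟨x n|b⟩).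
  by apply/funext => n; rewrite innerBr subrK.
rewrite -[⟨a|b⟩]add0r; apply: cvgD => //.
apply: cvg_inner_bounded_strong xM _.
by rewrite -(subrr b); apply: cvgB => //; exact: cvg_cst.
Qed.

(** Weak compactness of balls: the scalar limits of [<x n|u>] form a linear functional of [u]
    bounded by [M |u|], which the Riesz theorem represents by a vector. *)
Lemma ultra_weak_limit F x (M : R) : UltraFilter F ->
  (forall n, `|x n| <= M) ->
  exists a : H, forall u, ⟨x n|u⟩ @[n --> F] --> ⟨a|u⟩.
Proof.
move=> FU xM.
have /choice[phi phiP] : forall u, exists l, ⟨x n|u⟩ @[n --> F] --> (l : R).
  move=> u; apply: (ultra_cvg_bounded (M := M * `|u|)) => n.
  by rewrite (le_trans (norm_inner_le _ _))// ler_wpM2r.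
have [| |a aP] := @riesz_representation R H phi M.
- move=> c u v; apply: (@cvg_unique _ _ (fmap (fun n => ⟨x n|c *: u + v⟩) F)).
  + exact: norm_hausdorff.
  + exact: phiP.
  + have -> : (fun n => ⟨x n|c *: u + v⟩) = (fun n => c * ⟨x n|u⟩ + ⟨x n|v⟩).
      by apply/funext => n; rewrite !innerE.
    by apply: cvgD; [apply: cvgMr|]; exact: phiP.
- move=> u; apply: (cvgr_to_le (cvg_norm (phiP u))); apply: nearW => n.
  by rewrite (le_trans (norm_inner_le _ _))// ler_wpM2r.
- by exists a => u; rewrite -aP; exact: phiP.
Qed.

(* Opial's argument: if [a] and [b] are two weak cluster points,
   [|x n - a|^2 - |x n - b|^2] converges and is affine in [<x n|b - a>]. *)
Lemma opial x (Z : set H) (M : R) : (forall n, `|x n| <= M) ->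
  (forall z, Z z -> cvgn (fun n => `|x n - z| ^+ 2)) ->
  (forall F a, UltraFilter F -> \oo `<=` F ->
    (forall u, ⟨x n|u⟩ @[n --> F] --> ⟨a|u⟩) -> Z a) ->
  exists z, Z z /\ weakly_cvg x z.
Proof.
move=> xM x_cvg clusterZ.
have [F [FU ooF]] := @ultraFilterLemma nat \oo _.
have [a aF] := ultra_weak_limit FU xM.
have Za : Z a by exact: clusterZ aF.
(* One ultrafilter fixes the candidate [a]; it remains to see that any other one finer than [\oo]
   has the same weak limit. *)
exists a; split => // u; apply: cvg_ultraP => G GU ooG.
have [b bG] := ultra_weak_limit GU xM.
have Zb : Z b by exact: clusterZ bG.
suff -> : a = b by exact: bG.
have [l xl] : exists l : R, ⟨x n|b - a⟩ @[n --> \oo] --> l.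
  pose g n := 2^-1 * ((`|x n - a| ^+ 2 - `|x n - b| ^+ 2)
                       - (`|a| ^+ 2 - `|b| ^+ 2)).
  have -> : (fun n => ⟨x n|b - a⟩) = g.
    by apply/funext => n; rewrite /g !normBsq innerBr; lra.
  have [la lb] := (x_cvg a Za, x_cvg b Zb).
  eexists; apply: cvgMr; apply: cvgB; last exact: cvg_cst.
  by apply: cvgB; [exact: la|exact: lb].
(* The limit [l] along [\oo] is computed along [F] and along [G]; equating the two values gives
   [|b - a|^2 = 0]. *)
have ha : ⟨a|b - a⟩ = l.
  apply: (@cvg_unique _ _ (fmap (fun n => ⟨x n|b - a⟩) F)) => //.
  - exact: aF.
  - by move=> A /xl; exact: ooF.
have hb : ⟨b|b - a⟩ = l.
  apply: (@cvg_unique _ _ (fmap (fun n => ⟨x n|b - a⟩) G)) => //.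
  - exact: bG.
  - by move=> A /xl; exact: ooG.
apply/eqP; rewrite eq_sym -subr_eq0 -normr_eq0 -sqrf_eq0 -innerxx innerBl.
by rewrite ha hb subrr.
Qed.

(** Uniform boundedness principle for the functionals [<x n|.>], whose pointwise bounds come from
    convergence of the scalar sequences. *)
Lemma weakly_cvg_bounded x (a : H) : weakly_cvg x a ->
  exists M : R, forall n, `|x n| <= M.
Proof.
move=> xa.
pose T := [set (fun u : H => ⟨x n|u⟩ : R^o) | n in [set: nat]].
have [||M TM] := @Banach_Steinhauss R H R^o T _ _ 1.
- move=> _ [n _ <-]; split.
  + move=> r; exists (`|x n| * r) => u ur.
    by rewrite (le_trans (norm_inner_le _ _))// ler_wpM2l.
  + by move=> c u v; rewrite !innerE.
- move=> u; have /cvg_seq_bounded[M [_ /(_ (M + 1))]] : cvgn (fun n => ⟨x n|u⟩).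
    by apply/cvg_ex; exists ⟨a|u⟩; exact: xa.
  rewrite ltrDl ltr01 => /(_ isT) xM.
  by exists (M + 1) => _ [n _ <-]; exact: xM.
(* The uniform bound on the unit ball is tested at [x n / |x n|]; the absolute value of [M] serves
   the case [x n = 0]. *)
exists `|M| => n; have [->|xn0] := eqVneq (x n) 0; first by rewrite normr0.
have xn_gt0 : 0 < `|x n| by rewrite normr_gt0.
have := TM (fun u : H => ⟨x n|u⟩ : R^o) (ex_intro2 _ _ n I erefl)
  (`|x n|^-1 *: x n).
rewrite normrZ normrV ?unitfE ?gt_eqF// normr_id mulVf ?gt_eqF// => /(_ (lexx _)).
rewrite innerZr innerxx expr2 mulKf ?gt_eqF// normr_id => /le_trans; apply.
exact: ler_norm.
Qed.

End WeakConvergence.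

(** * Real series and sequences with nonnegative terms *)

Lemma nonneg_series_lty (R : realType) (u : nat -> R) (B : R) :
  (forall n, 0 <= u n) -> (forall n, \sum_(0 <= k < n) u k <= B) ->
  (\sum_(0 <= n <oo) (u n)%:E < +oo)%E.
Proof.
move=> u0 uB; apply: (@le_lt_trans _ _ B%:E); last exact: ltry.
apply: lime_le; first by apply: is_cvg_nneseries => n _ _; rewrite lee_fin.
by apply: nearW => n; rewrite sumEFin lee_fin.
Qed.

Lemma nonneg_series_cvg0 (R : realType) (u : nat -> R) (B : R) :
  (forall n, 0 <= u n) -> (forall n, \sum_(0 <= k < n) u k <= B) ->
  u n @[n --> \oo] --> (0 : R).
Proof.
move=> u0 uB; apply: (@cvg_series_cvg_0 _ R^o).
apply: nondecreasing_is_cvgn; last first.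
  by exists B => _ [n _ <-]; exact: uB.
by apply/nondecreasing_seqP => n; rewrite /series/= big_nat_recr//= lerDl.
Qed.

Lemma sqr_norm_cvg0 (R : realType) (V : normedModType R) (F : set_system nat)
    (f : nat -> V) : Filter F ->
  `|f n| ^+ 2 @[n --> F] --> (0 : R) -> f n @[n --> F] --> (0 : V).
Proof.
move=> FF /cvgr0Pnorm_lt f0; apply/cvgr0Pnorm_lt => e e0.
have := f0 (e ^+ 2); rewrite exprn_gt0// => /(_ isT); apply: filterS => n.
by rewrite ger0_norm ?exprn_ge0// ltr_pXn2r ?nnegrE ?normr_ge0 ?(ltW e0).
Qed.

Lemma nonincreasing_ge0_cvg (R : realType) (u : nat -> R) :
  (forall n, 0 <= u n) -> (forall n, u n.+1 <= u n) -> cvgn u.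
Proof.
move=> u0 uS; apply: nonincreasing_is_cvgn; first exact/nonincreasing_seqP.
by exists 0 => _ [n _ <-]; exact: u0.
Qed.

(** A positive limit [l] would give [r n > l / 2] eventually, hence [c n <= (4 / l^2) c n (r n)^2],
    and the series of [c] would converge. *)
Lemma weighted_cvg0_divergent (R : realType) (c r : nat -> R) (B : R) :
  (forall n, 0 <= c n <= 1) -> (forall n, 0 <= r n) ->
  (forall n, \sum_(0 <= k < n) c k * r k ^+ 2 <= B) ->
  (\sum_(0 <= n <oo) (c n)%:E = +oo)%E -> cvgn r -> r n @[n --> \oo] --> (0 : R).
Proof.
move=> c01 r0 crB c_div r_cvg; pose l := limn r.
suff l0 : l = 0 by rewrite -l0; exact: r_cvg.
have l_ge0 : 0 <= l by apply: (cvgr_to_ge r_cvg); exact: nearW.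
apply/eqP; rewrite eq_le l_ge0 andbT leNgt; apply/negP => l_gt0.
have lt_l : l / 2 < l by rewrite ltr_pdivrMr// ltr_pMr// ltrDr.
have [N _ rN] : \forall n \near \oo, l / 2 < r n.
  exact: (cvgr_gt l r_cvg).
pose K := 4 / l ^+ 2.
have K0 : 0 < K by rewrite divr_gt0// exprn_gt0.
have B0 : 0 <= B by have := crB 0%N; rewrite big_nil.
suff : (\sum_(0 <= n <oo) (c n)%:E < +oo)%E by rewrite c_div ltxx.
apply: (nonneg_series_lty (B := N%:R + K * B)).
  by move=> n; have /andP[] := c01 n.
(* Each index below [N] is charged at most 1, since [c n <= 1]; [minn n N] counts these indices so
   that the bound can be proved by induction. *)
suff h n : \sum_(0 <= k < n) c k <=
    (minn n N)%:R + K * \sum_(0 <= k < n) c k * r k ^+ 2.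
  move=> n; apply: (le_trans (h n)); apply: lerD.
    by rewrite ler_nat geq_minr.
  by rewrite ler_pM2l.
elim: n => [|n IH]; first by rewrite !big_nil min0n mulr0 addr0.
have hmin : (minn n.+1 N)%:R = (minn n N)%:R + (n < N)%N%:R :> R.
  rewrite -natrD; congr (_%:R); rewrite /minn.
  by do 2 case: ifP => //=; lia.
have hc : c n <= (n < N)%N%:R + K * (c n * r n ^+ 2).
  have /andP[cn0 cn1] := c01 n.
  have [nN|Nn] := ltnP n N.
    rewrite (le_trans cn1)// lerDl.
    exact: mulr_ge0 (ltW K0) (mulr_ge0 cn0 (sqr_ge0 _)).
  rewrite add0r mulrCA ler_peMr// /K mulrAC ler_pdivlMr ?exprn_gt0// mul1r.
  have := rN n Nn; rewrite /= => rn; have := r0 n.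
  by nra.
rewrite !big_nat_recr//= mulrDr hmin addrACA.
exact: lerD.
Qed.

(** * Monotone operators, demiclosedness and the separating half-space *)

Section Operators.
Context {R : realType} {H : hilbertType R}.
Implicit Types (W : H -> set H) (C U : H -> H).

Lemma zer_add_sv W C z : zer (add_op W (sv C)) z <-> W z (- C z).
Proof.
rewrite /zer /add_op /sv /=; split => [[a Wa [_ ->]] /eqP|Wz].
  by rewrite addr_eq0 => /eqP <-.
by exists (- C z) => //; exists (C z) => //; rewrite addNr.
Qed.

Lemma warped_resolvent_mem U W C x w :
  warped_resolvent U (add_op W (sv C)) x w -> W w (U x - U w - C w).
Proof.
move=> [_ ->] [_ [a Wa [_ ->] <-]] <-.
by rewrite [U w + _]addrC !addrK.
Qed.

Lemma monotone_mem W x x' y y' :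
  Defs.monotone W -> W x x' -> W y y' -> 0 <= ⟨x - y|x' - y'⟩.
Proof. by move=> mW Wx Wy; exact: (mW (x, x') (y, y')). Qed.

(** Adjoining [(z, a)] to the graph keeps it monotone, so by maximality the pair was already
    there. *)
Lemma maximally_monotone_mem W z a : maximally_monotone W ->
  (forall u v, W u v -> 0 <= ⟨z - u|a - v⟩) -> W z a.
Proof.
move=> [mW maxW] za; apply: contrapT => nWza.
pose N u := W u `|` [set v | u = z /\ v = a].
apply: (maxW N).
  move=> [u v] [u' v'] [Wuv|[/= -> ->]] [Wuv'|[/= -> ->]].
  - exact: mW.
  - by have := za _ _ Wuv; rewrite !innerE; lra.
  - exact: za.
  - by rewrite !subrr inner0r.
by split => [[u v] Wuv|/(_ (z, a)) NW]; [left|apply/nWza/NW; right].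
Qed.

Lemma cocoercive_lipschitz C (alpha : R) : 0 < alpha -> cocoercive alpha C ->
  forall x y, `|C x - C y| <= `|x - y| / alpha.
Proof.
move=> a0 coC x y; rewrite ler_pdivlMr//.
have [->|Cxy] := eqVneq (C x - C y) 0; first by rewrite normr0 mul0r.
have := le_trans (coC x y) (le_inner_norm _ _).
by rewrite expr2 mulrA ler_pM2r ?normr_gt0// mulrC.
Qed.

(* [C] is strongly convergent along [w] because cocoercivity against a known
   zero [z0] gives [alpha |C w - C z0|^2 <= <w - z0|a + C w>]; this replaces
   maximal monotonicity of [W + C]. *)
Lemma zer_add_demiclosed W C (alpha : R) (F : set_system nat) (w a : nat -> H)
    (z z0 : H) (M : R) : ProperFilter F ->
  0 < alpha -> maximally_monotone W -> cocoercive alpha C ->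
  zer (add_op W (sv C)) z0 -> (forall n, W (w n) (a n)) ->
  (forall n, `|w n| <= M) -> (forall u, ⟨w n|u⟩ @[n --> F] --> ⟨z|u⟩) ->
  a n + C (w n) @[n --> F] --> (0 : H) -> zer (add_op W (sv C)) z.
Proof.
move=> FF alpha0 maxW coC /zer_add_sv Wz0 Wwa wM wz aC0.
have wyM y n : `|w n - y| <= M + `|y|.
  by rewrite (le_trans (ler_normB _ _))// lerD2r.
have wy y u : ⟨w n - y|u⟩ @[n --> F] --> ⟨z - y|u⟩.
  rewrite innerBl; under eq_fun do rewrite innerBl.
  by apply: cvgB; [exact: wz|exact: cvg_cst].
have Cw : C (w n) @[n --> F] --> C z0.
  apply/subr_cvg0; apply: sqr_norm_cvg0.
  have up : alpha^-1 * ⟨w n - z0|a n + C (w n)⟩ @[n --> F] --> (0 : R).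
    rewrite -[X in _ --> X](mulr0 alpha^-1); apply: cvgMr.
    exact: cvg_inner_bounded_strong (wyM z0) aC0.
  refine (squeeze_cvgr _ (cvg_cst 0) up); apply: nearW => n.
  rewrite sqr_ge0/= ler_pdivlMl//; apply: le_trans (coC _ _) _.
  have := monotone_mem maxW.1 (Wwa n) Wz0.
  by rewrite opprK !innerE; lra.
(* Cocoercivity passes to the limit: its right side pairs the weakly null [w n - z] with a strongly
   convergent sequence and tends to 0. *)
have Cz : C z = C z0.
  have h1 : ⟨w n - z|C (w n) - C z⟩ @[n --> F] --> ⟨z - z|C z0 - C z⟩.
    apply: cvg_inner_weak_strong (wyM z) (wy z) _.
    by apply: cvgB => //; exact: cvg_cst.
  have h2 : alpha * `|C (w n) - C z| ^+ 2 @[n --> F] -->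
      alpha * `|C z0 - C z| ^+ 2.
    apply: cvgMr; rewrite expr2; under eq_fun do rewrite expr2.
    have h : `|C (w n) - C z| @[n --> F] --> `|C z0 - C z|.
      by apply: cvg_norm; apply: cvgB => //; exact: cvg_cst.
    exact: cvgM.
  have : alpha * `|C z0 - C z| ^+ 2 <= 0.
    rewrite [leRHS](_ : _ = ⟨z - z|C z0 - C z⟩); last first.
      by rewrite subrr innerC inner0r.
    rewrite -subr_ge0; apply: (cvgr_to_ge (cvgB h1 h2)).
    by apply: nearW => n; rewrite subr_ge0; exact: coC.
  rewrite pmulr_rle0// => h; apply/esym/eqP.
  by rewrite -subr_eq0 -normr_eq0 -sqrf_eq0 eq_le h sqr_ge0.
apply/zer_add_sv; rewrite Cz; apply: maximally_monotone_mem => // u v Wuv.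
(* Strong convergence of [a] lets monotonicity against any [(u, v)] in the graph of [W] pass to the
   limit. *)
have ha : a n @[n --> F] --> - C z0.
  rewrite -[X in _ --> X]add0r.
  have -> : a = (fun n => (a n + C (w n)) - C (w n)).
    by apply/funext => n; rewrite addrK.
  exact: cvgB.
have h : ⟨w n - u|a n - v⟩ @[n --> F] --> ⟨z - u| - C z0 - v⟩.
  apply: cvg_inner_weak_strong (wyM u) (wy u) _.
  by apply: cvgB => //; exact: cvg_cst.
apply: (cvgr_to_ge h); apply: nearW => n.
exact: monotone_mem maxW.1 (Wwa n) Wuv.
Qed.

(** Monotonicity at [w] and [z], cocoercivity at [q] and [z], and Cauchy-Schwarz bound the left side
    by [p c - alpha c^2], whose maximum over [c] is [p^2 / (4 alpha)]. *)
Lemma halfspace_separation W C (alpha : R) (w q t z : H) :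
  0 < alpha -> Defs.monotone W -> cocoercive alpha C ->
  zer (add_op W (sv C)) z -> W w (t - C q) ->
  ⟨z - w|t⟩ <= `|w - q| ^+ 2 / (4 * alpha).
Proof.
move=> alpha0 mW coC /zer_add_sv Wz Ww.
have := monotone_mem mW Ww Wz; have := coC q z.
have := norm_inner_le (w - q) (C q - C z).
rewrite ler_norml => /andP[+ _].
set c := `|C q - C z|; set p := `|w - q| => h1 h2 h3.
have h4 : ⟨z - w|t⟩ <= p * c - alpha * c ^+ 2.
  by move: h1 h2 h3; rewrite opprK !innerE; lra.
apply: (le_trans h4); rewrite ler_pdivlMr ?mulr_gt0//.
by have := sqr_ge0 (p - 2 * alpha * c); nra.
Qed.

(** Expanding the square reduces the claim to [|d|^2 <= <x - z|d>]. When [delta > 0] this amounts to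
    [delta <= <x - z|t>], which is the half-space inequality for [z]. *)
Lemma relaxed_projection_fejer (x z w t d : H) (delta eps lambda : R) :
  0 <= eps -> 0 <= lambda -> delta = ⟨x - w|t⟩ - eps -> ⟨z - w|t⟩ <= eps ->
  d = (if 0 < delta then (delta / `|t| ^+ 2) *: t else 0) ->
  `|x - lambda *: d - z| ^+ 2 <=
    `|x - z| ^+ 2 - lambda * (2 - lambda) * `|d| ^+ 2.
Proof.
move=> eps0 lambda0 deltaE zw dE.
suff h : `|d| ^+ 2 <= ⟨x - z|d⟩.
  rewrite (addrAC x) (normBsq (x - z)) innerZr normrZ exprMn real_normK ?num_real//.
  by have := ler_wpM2l lambda0 h; lra.
rewrite dE; case: ifPn => [delta0|_]; last by rewrite normr0 inner0r expr0n.
have t0 : t != 0.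
  apply/eqP => t0; move: delta0; rewrite deltaE t0 inner0r sub0r oppr_gt0.
  by rewrite ltNge eps0.
have tt0 : 0 < `|t| ^+ 2 by rewrite exprn_gt0// normr_gt0.
have dt0 : 0 < delta / `|t| ^+ 2 by rewrite divr_gt0.
rewrite innerZr normrZ exprMn real_normK ?num_real//.
set s := delta / _ in dt0 *; rewrite [leLHS](_ : _ = s * (s * `|t| ^+ 2)); last by ring.
rewrite ler_pM2l// /s divfK ?gt_eqF// deltaE.
by move: zw; rewrite !innerE; lra.
Qed.

End Operators.

(** * Error estimate for strongly monotone Lipschitzian kernels *)

Lemma quadratic_bound (R : realFieldType) (c K s eta : R) :
  0 < c -> 0 <= K -> 0 <= eta -> 0 <= s ->
  c * s ^+ 2 <= K * (eta * s + eta ^+ 2) -> s <= (1 + 2 * K / c) * eta.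
Proof.
move=> c0 K0 eta0 s0 h.
have Kc : 0 <= 2 * K / c by rewrite divr_ge0 ?mulr_ge0// ltW.
have [s_eta|eta_s] := lerP s eta.
  by rewrite (le_trans s_eta)// mulrDl mul1r lerDl mulr_ge0.
have s_gt0 : 0 < s by rewrite (le_lt_trans eta0).
(* Here [eta < s], so [eta^2 <= eta s], and a factor [s] cancels. *)
have : s <= 2 * K / c * eta.
  rewrite -(ler_pM2l c0) [leRHS](_ : _ = 2 * K * eta); last first.
    by field; rewrite gt_eqF.
  rewrite -(ler_pM2r s_gt0) -mulrA -expr2 (le_trans h)//.
  by have := mulr_ge0 K0 eta0; nra.
by rewrite mulrDl mul1r; lra.
Qed.

(* Condition (d) forces [x - w] to be of the order of [|d| + |q - x|]. *)
Lemma strongly_monotone_step (R : realType) (H : hilbertType R)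
    (U C : H -> H) (alpha beta1 beta2 delta : R) (x w q t d : H) :
  0 < alpha -> cocoercive alpha C -> 1 / (4 * alpha) < beta1 -> 0 < beta2 ->
  strongly_monotone beta1 (sv U) ->
  (forall y z, `|U y - U z| <= beta2 * `|y - z|) ->
  t = U x - U w - C w + C q ->
  delta = ⟨x - w|t⟩ - `|w - q| ^+ 2 / (4 * alpha) ->
  d = (if 0 < delta then (delta / `|t| ^+ 2) *: t else 0) ->
  `|x - w| <= (1 + 2 * (beta2 + 3 / alpha) / (beta1 - 1 / (4 * alpha))) *
              (`|d| + `|q - x|).
Proof.
move=> alpha0 coC beta1_gt beta2_gt0 smU lipU tE deltaE dE.
(* Equality holds when [delta > 0], by the choice of [d]; otherwise the left side is nonpositive. *)
have delta_le : delta <= `|d| * `|t|.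
  rewrite dE; case: ifPn => [delta0|]; last by rewrite normr0 mul0r -leNgt.
  have [t0|t0] := eqVneq t 0.
    move: delta0; rewrite deltaE t0 inner0r sub0r oppr_gt0 ltNge.
    by rewrite divr_ge0 ?exprn_ge0// mulr_ge0// ltW.
  rewrite normrZ ger0_norm; last by rewrite divr_ge0 ?exprn_ge0// ltW.
  by rewrite -mulrA -[X in _ * X]expr2 divfK// expf_neq0// normr_eq0.
set s := `|x - w|; set e := `|q - x|; set D := `|d|.
pose p := `|w - q|; pose g := `|C q - C w|; pose k := alpha^-1.
have k0 : 0 < k by rewrite invr_gt0.
have [s0 e0 D0 p0] : [/\ 0 <= s, 0 <= e, 0 <= D & 0 <= p].
  by split; exact: normr_ge0.
have p_le : p <= s + e.
  rewrite /p (_ : w - q = (w - x) + (x - q)); last by rewrite addrA subrK.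
  by rewrite (le_trans (ler_normD _ _))// (distrC w) (distrC x q).
have g_le : g <= k * p.
  rewrite mulrC /g /p (distrC w); exact: (cocoercive_lipschitz alpha0 coC).
have t_le : `|t| <= beta2 * s + k * p.
  rewrite tE -addrA (addrC (- C w)).
  rewrite (le_trans (ler_normD _ _))//; exact: lerD (lipU _ _) g_le.
(* [<x - w|t>] splits into the three products bounded below in [sm], [xq] and [qw]: strong
   monotonicity, Cauchy-Schwarz and cocoercivity. *)
have sm : beta1 * s ^+ 2 <= ⟨x - w|U x - U w⟩.
  exact: (smU (x, U x) (w, U w)).
have xq : - (e * g) <= ⟨x - q|C q - C w⟩.
  have := norm_inner_le (x - q) (C q - C w).
  by rewrite ler_norml (distrC x q) => /andP[].
have qw : 0 <= ⟨q - w|C q - C w⟩.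
  by apply: le_trans (coC q w); rewrite mulr_ge0 ?exprn_ge0// ltW.
have c0 : 0 < beta1 - 1 / (4 * alpha) by rewrite subr_gt0.
have kE : 1 / (4 * alpha) = k / 4 by rewrite /k; field; rewrite gt_eqF.
apply: quadratic_bound => //.
- by rewrite addr_ge0 ?ltW// divr_gt0.
- by rewrite addr_ge0.
have h1 : beta1 * s ^+ 2 - e * g - k / 4 * p ^+ 2 <= D * `|t|.
  apply: le_trans delta_le; rewrite deltaE -/p -kE div1r (mulrC _ (p ^+ 2)).
  by move: sm xq qw; rewrite tE !innerE; lra.
have h2 : D * `|t| <= D * (beta2 * s + k * (s + e)).
  rewrite ler_wpM2l// (le_trans t_le)// lerD2l.
  by rewrite ler_wpM2l// ltW.
have h3 : e * g <= e * (k * (s + e)).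
  by rewrite ler_wpM2l// (le_trans g_le)// ler_wpM2l// ltW.
have h4 : k / 4 * p ^+ 2 <= k / 4 * (s + e) ^+ 2.
  apply: ler_wpM2l; first by rewrite divr_ge0// ltW.
  by rewrite ler_pXn2r// nnegrE addr_ge0.
have -> : 3 / alpha = 3 * k by [].
rewrite kE.
have h5 : beta1 * s ^+ 2 <= D * (beta2 * s + k * (s + e))
    + e * (k * (s + e)) + k / 4 * (s + e) ^+ 2 by lra.
(* Once [k / 4 * s^2] moves to the left, no monomial carries more than [3/2] times [k], so
   [beta2 + 3 * k] suffices as [K] with [eta = D + e]. The products below are the nonnegative
   monomials that [lra] needs. *)
have ks := mulr_ge0 (ltW k0) (mulr_ge0 e0 s0).
have kDs := mulr_ge0 (ltW k0) (mulr_ge0 D0 s0).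
have kDe := mulr_ge0 (ltW k0) (mulr_ge0 D0 e0).
have kee := mulr_ge0 (ltW k0) (mulr_ge0 e0 e0).
have kDD := mulr_ge0 (ltW k0) (mulr_ge0 D0 D0).
have bes := mulr_ge0 (ltW beta2_gt0) (mulr_ge0 e0 s0).
have bsq := mulr_ge0 (ltW beta2_gt0) (sqr_ge0 (D + e)).
lra.
Qed.

Theorem theorem4p12 (R : realType) (H : hilbertType R)
  (alpha : R) (alpha_gt0 : 0 < alpha)
  (W : H -> set H) (W_maxmon : maximally_monotone W)
  (C : H -> H) (C_coco : cocoercive alpha C)
  (Z_neq0 : zer (add_op W (sv C)) !=set0)
  (x0 : H)
  (lambda : nat -> R) (lambda02 : forall n, 0 < lambda n < 2)
  (U : nat -> H -> H)
  (U_ran : forall n,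
    ran (sv (U n)) `<=` ran (add_op (sv (U n)) (add_op W (sv C))))
  (U_inj : forall n, injective_op (add_op (sv (U n)) (add_op W (sv C))))
  (x w wstar q tstar d : nat -> H) (delta : nat -> R)
  (x_0 : x 0%N = x0)
  (wE : forall n, warped_resolvent (U n) (add_op W (sv C)) (x n) = [set w n])
  (wstarE : forall n, wstar n = U n (x n) - U n (w n) - C (w n))
  (tstarE : forall n, tstar n = wstar n + C (q n))
  (deltaE : forall n,
    delta n = ⟨x n - w n | tstar n⟩ - `|w n - q n| ^+ 2 / (4 * alpha))
  (dE : forall n, d n =
    if 0 < delta n then (delta n / `|tstar n| ^+ 2) *: tstar n else 0)
  (x_S : forall n, x n.+1 = x n - lambda n *: d n) :
  (\sum_(0 <= n <oo) (lambda n * (2 - lambda n) * `|d n| ^+ 2)%:E < +oo)%E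
  /\
  ( ( ((\sum_(0 <= n <oo) (lambda n * (2 - lambda n))%:E = +oo)%E
        /\ cvg (`|d n| @[n --> \oo]))
      \/
      (0 < inf (range lambda) /\ sup (range lambda) < 2) )
    ->
    ( [/\ weakly_cvg (fun n => w n - x n) 0,
          U n (w n) - U n (x n) @[n --> \oo] --> (0 : H)
        & w n - q n @[n --> \oo] --> (0 : H)]
      \/
      (q n - x n @[n --> \oo] --> (0 : H) /\
       exists beta1 beta2 : R,
         [/\ 1 / (4 * alpha) < beta1, 0 < beta2
           & forall n, strongly_monotone beta1 (sv (U n)) /\
                       beta2.-lipschitz (U n)]) )
    ->
    exists z, zer (add_op W (sv C)) z /\ weakly_cvg x z ).
Proof.
have W_mon := W_maxmon.1.
have Ww n : W (w n) (wstar n).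
  by rewrite wstarE; apply: (@warped_resolvent_mem _ _ _ W C); rewrite wE.
have lambda_ge0 n : 0 <= lambda n by have /andP[/ltW] := lambda02 n.
have c01 n : 0 <= lambda n * (2 - lambda n) <= 1.
  have /andP[l0 l2] := lambda02 n; apply/andP; split; last first.
    by have := sqr_ge0 (1 - lambda n); lra.
  by rewrite mulr_ge0// subr_ge0 ltW.
have fejer z n : zer (add_op W (sv C)) z -> `|x n.+1 - z| ^+ 2 <=
    `|x n - z| ^+ 2 - lambda n * (2 - lambda n) * `|d n| ^+ 2.
  move=> Zz; rewrite x_S.
  apply: (relaxed_projection_fejer _ _ (deltaE n) _ (dE n)) => //.
    by rewrite divr_ge0 ?exprn_ge0// mulr_ge0// ltW.
  by apply: halfspace_separation Zz _ => //; rewrite tstarE addrK.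
have cd_ge0 n : 0 <= lambda n * (2 - lambda n) * `|d n| ^+ 2.
  by rewrite mulr_ge0 ?exprn_ge0//; have /andP[] := c01 n.
have [z0 Zz0] := Z_neq0.
have sum_le n : \sum_(0 <= k < n) lambda k * (2 - lambda k) * `|d k| ^+ 2 <=
    `|x 0%N - z0| ^+ 2.
  (* Keeping the term [- |x n - z0|^2] makes the bound telescope under induction. *)
  suff : \sum_(0 <= k < n) lambda k * (2 - lambda k) * `|d k| ^+ 2 <=
      `|x 0%N - z0| ^+ 2 - `|x n - z0| ^+ 2.
    by move=> /le_trans; apply; rewrite gerBl exprn_ge0.
  elim: n => [|n IH]; first by rewrite big_nil subrr.
  by rewrite big_nat_recr//=; have := fejer z0 n Zz0; lra.
split; first exact: nonneg_series_lty cd_ge0 sum_le.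
move=> lambda_cond cvg_cond.
have x_cvg z : zer (add_op W (sv C)) z -> cvgn (fun n => `|x n - z| ^+ 2).
  move=> Zz; apply: nonincreasing_ge0_cvg => n; first by rewrite exprn_ge0.
  by rewrite (le_trans (fejer z n Zz))// gerBl.
have [Mx xM] : exists M, forall n, `|x n| <= M.
  exists (`|x 0%N - z0| + `|z0|) => n.
  have le0 : `|x n - z0| <= `|x 0%N - z0|.
    rewrite -(ler_pXn2r (n := 2)) ?nnegrE//.
    have := sum_le n; elim: n => [//|n IH] _.
    by rewrite (le_trans (fejer z0 n Zz0))// (le_trans _ (IH (sum_le n)))// gerBl.
  by rewrite -[x n](subrK z0) (le_trans (ler_normD _ _))// lerD2r.
(* Under (c) both limits are assumed; under (d) they follow from [d n --> 0] and
   [q n - x n --> 0]. *)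
have [wx Uwx] : weakly_cvg (fun n => w n - x n) 0 /\
    U n (w n) - U n (x n) @[n --> \oo] --> (0 : H).
  case: cvg_cond => [[]//|[qx [beta1 [beta2 [beta1_gt beta2_gt0 Ubeta]]]]].
  have lipU n y z : `|U n y - U n z| <= beta2 * `|y - z|.
    by have [_ lip] := Ubeta n; exact: (lip (y, z)).
  have d0 : `|d n| @[n --> \oo] --> (0 : R).
    case: lambda_cond => [[c_div d_cvg]|[inf_gt0 sup_lt2]].
      apply: (weighted_cvg0_divergent c01 _ sum_le c_div d_cvg) => n.
      exact: normr_ge0.
    (* Under (b) this product bounds the weights [lambda n (2 - lambda n)] from below, so dividing
       [sum_le] by it bounds the partial sums of [|d n|^2]. *)
    have eps0 : 0 < inf (range lambda) * (2 - sup (range lambda)).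
      by rewrite mulr_gt0// subr_gt0.
    have lb n : inf (range lambda) <= lambda n.
      apply: ge_inf; last by exists n.
      by exists 0 => _ [k _ <-].
    have ub n : lambda n <= sup (range lambda).
      apply: ub_le_sup; last by exists n.
      by exists 2 => _ [k _ <-]; have /andP[_ /ltW] := lambda02 k.
    apply/norm_cvg0P; apply: sqr_norm_cvg0.
    apply: (nonneg_series_cvg0 (B := (inf (range lambda) *
      (2 - sup (range lambda)))^-1 * `|x 0%N - z0| ^+ 2)) => n.
      exact: exprn_ge0.
    rewrite ler_pdivlMl// mulr_sumr (le_trans _ (sum_le n))//.
    apply: ler_sum => k _; rewrite ler_wpM2r ?exprn_ge0//.
    by apply: ler_pM; rewrite ?lerD2l ?lerN2// ?subr_ge0 ltW.
  have wx0 : w n - x n @[n --> \oo] --> (0 : H).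
    pose K := 1 + 2 * (beta2 + 3 / alpha) / (beta1 - 1 / (4 * alpha)).
    have up : K * (`|d n| + `|q n - x n|) @[n --> \oo] --> (0 : R).
      rewrite -[X in _ --> X](mulr0 K); apply: cvgMr.
      rewrite -[X in _ --> X](addr0 0); apply: cvgD => //.
      exact/norm_cvg0P.
    apply/norm_cvg0P; refine (squeeze_cvgr _ (cvg_cst 0) up).
    apply: nearW => n; rewrite normr_ge0/= distrC.
    apply: strongly_monotone_step _ (deltaE n) (dE n) => //.
    - exact: (Ubeta n).1.
    - by rewrite tstarE wstarE.
  split.
    move=> u; rewrite [⟨0|u⟩]innerC inner0r; under eq_fun do rewrite innerC.
    exact: cvg_inner_bounded_strong (fun=> lexx `|u|) wx0.
  have up : beta2 * `|w n - x n| @[n --> \oo] --> (0 : R).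
    by rewrite -[X in _ --> X](mulr0 beta2); apply: cvgMr; exact/norm_cvg0P.
  apply/norm_cvg0P; refine (squeeze_cvgr _ (cvg_cst 0) up).
  by apply: nearW => n; rewrite normr_ge0/=.
have [Mwx wxM] := weakly_cvg_bounded wx.
have wM n : `|w n| <= Mwx + Mx.
  by rewrite -[w n](subrK (x n)) (le_trans (ler_normD _ _))// lerD.
apply: opial xM x_cvg _ => F a FU ooF xa.
apply: (@zer_add_demiclosed _ _ W C alpha F w wstar a z0 (Mwx + Mx)) => //.
(* Since [w n - x n] is weakly null, [w] has the weak limit [a] of [x] along [F]. *)
- move=> u.
  have -> : (fun n => ⟨w n|u⟩) = (fun n => ⟨w n - x n|u⟩ + ⟨x n|u⟩).
    by apply/funext => n; rewrite innerBl subrK.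
  rewrite -[⟨a|u⟩]add0r; apply: cvgD => //.
  by move=> A A0; apply: ooF; apply: wx; rewrite innerC inner0r.
- have -> : (fun n => wstar n + C (w n)) = (fun n => - (U n (w n) - U n (x n))).
    by apply/funext => n; rewrite wstarE subrK opprB.
  rewrite -[X in _ --> X]oppr0; apply: cvgN.
  by move=> A /Uwx; exact: ooF.
Qed.
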